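(* Let $q \in \mathbb{Q}^+$ be written as the irreducible fraction $q = \frac{c}{d}$ with $c,d$ positive integers. Let $\mathcal{W}_q$ be the set of all finite binary words $w$ (of any length $n \ge 0$, including the empty word) such that for every maximal factor of $w$ of the form $0^a1^b$ with $a > 0$ one has $aq > b$. Let $w_{r,i}$ be the number of words in $\mathcal{W}_q$ containing exactly $r$ zeros and $i$ ones, and let $W_q(y,z) = \sum_{r=0}^\infty \sum_{i=0}^\infty w_{r,i} z^r y^i$. Then, as formal power series, $$W_q(y,z) = \frac{1 - z^d y^c}{(1-y)\big(1 - z^d y^c - P_q(y,z)\big)}, \qquad \text{where } P_q(y,z) = \sum_{i=0}^{c-1} z^{1+\lfloor i/q \rfloor} y^i .$$
   Context: Here $x^\ell$ denotes the word consisting of $\ell$ copies of the symbol $x$. A maximal factor of the form $0^a1^b$ means a maximal run of $a$ consecutive zeros followed immediately by the maximal run of $b \ge 0$ consecutive ones that follows it (so e.g. a word ending in $0^a$ has the factor $0^a1^0$). The polynomial $P_q(y,z)$ is called the model polynomial of $q$. *)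

(* Defs.v *)
From HB Require Import structures.
From mathcomp Require Import all_boot all_order all_algebra.
From mathcomp Require Import boolp classical_sets.

Set Implicit Arguments.
Unset Strict Implicit.
Unset Printing Implicit Defensive.

Import Order.TTheory GRing.Theory Num.Theory.

Local Open Scope ring_scope.

(* Formal power series in one variable over R, as coefficient sequences.      *)
(* A record rather than a bare [nat -> R], so that the Cauchy product does    *)
(* not clash with the pointwise ring structure on functions.                  *)
Record fps (R : Type) := FPS { coefs : nat -> R }.

Lemma fpsP (R : Type) (f g : fps R) : coefs f =1 coefs g -> f = g.
Proof. by case: f g => f [g] /= /funext ->. Qed.

HB.instance Definition _ (R : Type) := gen_eqMixin (fps R).
HB.instance Definition _ (R : Type) := gen_choiceMixin (fps R).

Section FpsZmodule.
Variable R : zmodType.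
Implicit Types f g h : fps R.

Definition fps_zero : fps R := FPS (fun=> 0).
Definition fps_opp f := FPS (fun n => - coefs f n).
Definition fps_add f g := FPS (fun n => coefs f n + coefs g n).

Fact fps_addA : associative fps_add.
Proof. by move=> f g h; apply: fpsP => n /=; rewrite addrA. Qed.
Fact fps_addC : commutative fps_add.
Proof. by move=> f g; apply: fpsP => n /=; rewrite addrC. Qed.
Fact fps_add0 : left_id fps_zero fps_add.
Proof. by move=> f; apply: fpsP => n /=; rewrite add0r. Qed.
Fact fps_addN : left_inverse fps_zero fps_opp fps_add.
Proof. by move=> f; apply: fpsP => n /=; rewrite addNr. Qed.

HB.instance Definition _ :=
  GRing.isZmodule.Build (fps R) fps_addA fps_addC fps_add0 fps_addN.

Lemma coefs0 n : coefs (0 : fps R) n = 0. Proof. by []. Qed.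
Lemma coefsD f g n : coefs (f + g) n = coefs f n + coefs g n.
Proof. by []. Qed.
Lemma coefsN f n : coefs (- f) n = - coefs f n. Proof. by []. Qed.
Lemma coefsB f g n : coefs (f - g) n = coefs f n - coefs g n.
Proof. by []. Qed.

End FpsZmodule.

Section FpsRing.
Variable R : comNzRingType.
Implicit Types f g h : fps R.

Definition fpsC (a : R) : fps R := FPS (fun n => if n == 0%N then a else 0).
Definition fpsX : fps R := FPS (fun n => (n == 1%N)%:R).

Definition fps_mul f g :=
  FPS (fun n => \sum_(i < n.+1) coefs f i * coefs g (n - i)%N).

Let trunc n f : {poly R} := \poly_(i < n.+1) coefs f i.

Let coef_trunc n f i : (i <= n)%N -> (trunc n f)`_i = coefs f i.
Proof. by move=> le_in; rewrite coef_poly ltnS le_in. Qed.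

Let coefs_mul n f g i : (i <= n)%N ->
  coefs (fps_mul f g) i = (trunc n f * trunc n g)`_i.
Proof.
move=> le_in; rewrite coefM; apply: eq_bigr => j _.
have le_jn : (j <= n)%N by rewrite (leq_trans _ le_in) // -ltnS.
by rewrite !coef_trunc // (leq_trans (leq_subr _ _)).
Qed.

Fact fps_mulC : commutative fps_mul.
Proof.
by move=> f g; apply: fpsP => n; rewrite !(coefs_mul _ _ (leqnn n)) mulrC.
Qed.

Fact fps_mulA : associative fps_mul.
Proof.
move=> f g h; apply: fpsP => n; rewrite !(coefs_mul _ _ (leqnn n)).
transitivity (trunc n f * (trunc n g * trunc n h))`_n.
  rewrite !coefM; apply: eq_bigr => i _.
  rewrite (coef_trunc (fps_mul g h) (leq_subr i n)).
  by rewrite (coefs_mul _ _ (leq_subr i n)).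
rewrite mulrA coefM [in RHS]coefM; apply: eq_bigr => i _; congr (_ * _).
have le_in : (i <= n)%N by rewrite -ltnS.
by rewrite (coef_trunc (fps_mul f g) le_in) (coefs_mul _ _ le_in).
Qed.

Fact fps_mul1 : left_id (fpsC 1) fps_mul.
Proof.
move=> f; apply: fpsP => n /=.
by rewrite big_ord_recl /= mul1r subn0 big1 ?addr0// => i _; rewrite mul0r.
Qed.

Fact fps_mulDl : left_distributive fps_mul +%R.
Proof.
move=> f g h; apply: fpsP => n /=; rewrite -big_split /=.
by apply: eq_bigr => i _; rewrite mulrDl.
Qed.

Fact fps_one_neq0 : fpsC 1 != 0.
Proof.
by apply/eqP => /(congr1 (fun f => coefs f 0)) /= /eqP; rewrite oner_eq0.
Qed.

HB.instance Definition _ := GRing.Zmodule_isComNzRing.Build (fps R)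
  fps_mulA fps_mulC fps_mul1 fps_mulDl fps_one_neq0.

Lemma coefs1 n : coefs (1 : fps R) n = (n == 0%N)%:R.
Proof. by case: n. Qed.

Lemma coefsM f g n :
  coefs (f * g) n = \sum_(i < n.+1) coefs f i * coefs g (n - i)%N.
Proof. by []. Qed.

Lemma coefs0M f g : coefs (f * g) 0 = coefs f 0 * coefs g 0.
Proof. by rewrite coefsM big_ord_recl big_ord0 addr0. Qed.

Lemma coefsCM a f n : coefs (fpsC a * f) n = a * coefs f n.
Proof.
by rewrite coefsM big_ord_recl /= subn0 big1 ?addr0// => i _; rewrite mul0r.
Qed.

Lemma fpsCX a n : fpsC a ^+ n = fpsC (a ^+ n).
Proof.
elim: n => [|n IHn]; first by rewrite !expr0.
rewrite !exprS IHn; apply: fpsP => m; rewrite coefsCM /=.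
by case: eqP; rewrite ?mulr0.
Qed.

Lemma coefsXM f n : coefs (fpsX * f) n = if n is m.+1 then coefs f m else 0.
Proof.
rewrite coefsM big_ord_recl /= mul0r add0r; case: n => [|n].
  by rewrite big_ord0.
rewrite big_ord_recl /= mul1r subSS subn0 big1 ?addr0// => i _.
by rewrite mul0r.
Qed.

Lemma coefsX k n : coefs (fpsX ^+ k) n = (n == k)%:R.
Proof.
by elim: k n => [|k IHk] [|n]; rewrite ?expr0 ?coefs1// exprS coefsXM ?IHk.
Qed.

Lemma coefsXnM f k n :
  coefs (fpsX ^+ k * f) n = if (k <= n)%N then coefs f (n - k) else 0.
Proof.
elim: k n => [|k IHk] [|n]; rewrite ?expr0 ?mul1r// exprS -mulrA coefsXM//.
Qed.

End FpsRing.

Arguments fpsX {R}.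

Section FpsUnitRing.
Variable R : comUnitRingType.
Implicit Types f g h : fps R.

Definition fps_unit : {pred fps R} := fun f => `[< exists g, g * f = 1 >].
Definition fps_inv f : fps R := xget f [set g | g * f = 1]%classic.

Fact fps_mulVx : {in fps_unit, left_inverse 1 fps_inv *%R}.
Proof. by move=> f /asboolP /(xgetPex f). Qed.

Fact fps_unitPl f g : g * f = 1 -> fps_unit f.
Proof. by move=> gf1; apply/asboolP; exists g. Qed.

Fact fps_invr_out : {in [predC fps_unit], fps_inv =1 id}.
Proof.
move=> f /negP nUf; apply: xgetPN => g gf1; apply: nUf.
exact: fps_unitPl gf1.
Qed.

HB.instance Definition _ := GRing.ComNzRing_hasMulInverse.Build (fps R)
  fps_mulVx fps_unitPl fps_invr_out.

Let inv_seq f := fix loop n := if n is m.+1 then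
  let t := loop m in
  rcons t (if m == 0%N then (coefs f 0)^-1
           else - (coefs f 0)^-1 * \sum_(i < m) t`_i * coefs f (m - i)%N)
  else [::].

Let size_inv_seq f n : size (inv_seq f n) = n.
Proof. by elim: n => //= n IHn; rewrite size_rcons IHn. Qed.

Let nth_inv_seq f n i : (i < n)%N -> (inv_seq f n)`_i = (inv_seq f i.+1)`_i.
Proof.
elim: n => // n IHn; rewrite ltnS leq_eqVlt => /predU1P[->// | lt_in].
by rewrite [inv_seq f n.+1]/= nth_rcons size_inv_seq lt_in IHn.
Qed.

Lemma fps_unitE f : (f \is a GRing.unit) = (coefs f 0 \is a GRing.unit).
Proof.
apply/idP/idP => [Uf | Uf0].
  apply/unitrPr; exists (coefs f^-1 0).
  by rewrite -coefs0M divrr // coefs1.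
apply: (@fps_unitPl f (FPS (fun n => (inv_seq f n.+1)`_n))).
apply: fpsP => n; rewrite coefsM coefs1 big_ord_recr subnn /=.
rewrite nth_rcons size_inv_seq ltnn eqxx.
case: n => [|n]; first by rewrite big_ord0 add0r mulVr.
rewrite mulrAC mulNr mulVr // mulN1r; apply/eqP; rewrite subr_eq0; apply/eqP.
by apply: eq_bigr => i _; rewrite [in RHS]nth_inv_seq.
Qed.

End FpsUnitRing.

(* Bivariate formal power series over the integers, as Z[[y]][[z]]: the outer *)
(* index is the exponent of z, the inner one the exponent of y.               *)
Definition fps2 := fps (fps int).

HB.instance Definition _ := GRing.ComUnitRing.on fps2.

Definition varz : fps2 := fpsX.
Definition vary : fps2 := fpsC fpsX.

Definition coef2 (F : fps2) (r i : nat) : int := coefs (coefs F r) i.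

Lemma coef2_monomial (a b r i : nat) :
  coef2 (varz ^+ a * vary ^+ b) r i = ((r == a) && (i == b))%:R.
Proof.
rewrite /coef2 /vary mulrC fpsCX coefsCM coefsX.
by case: (r == a); rewrite ?mulr1 ?mulr0 ?coefsX.
Qed.

Lemma fps2_unitE (F : fps2) :
  (F \is a GRing.unit) = (coef2 F 0 0 \is a GRing.unit).
Proof. by rewrite [LHS]fps_unitE fps_unitE. Qed.

(* Binary words are sequences of booleans: [false] is 0 and [true] is 1.      *)
(* The default values of [last] and [head] make the three boundary conditions *)
(* hold at the ends of the word: the 0-run is not preceded by a 0, it is not  *)
(* followed by a 0, and the 1-run is not followed by a 1.                     *)
Definition maximal_factor (w : seq bool) (a b : nat) : Prop :=
  exists u v : seq bool,
    [/\ w = u ++ nseq a false ++ nseq b true ++ v,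
        last true u = true,
        head true (nseq b true ++ v) = true &
        head false v = false].

Definition words (q : rat) (w : seq bool) : Prop :=
  forall a b : nat, (0 < a)%N -> maximal_factor w a b -> b%:R < a%:R * q.

(* A word with r zeros and i ones has length r + i.                           *)
Definition nb_words (q : rat) (r i : nat) : nat :=
  #|[set w : (r + i).-tuple bool |
      [&& `[< words q w >], count_mem false w == r & count_mem true w == i]]|.

Definition W (q : rat) : fps2 :=
  FPS (fun r => FPS (fun i => (nb_words q r i)%:Z)).

(* [c] is meant to be the numerator of [q] in lowest terms; as [i / q] is     *)
(* nonnegative, [Num.truncn] is its floor.                                    *)
Definition model_polynomial (q : rat) (c : nat) : fps2 :=
  \sum_(i < c) varz ^+ (1 + Num.truncn (i%:R / q)) * vary ^+ i.

Lemma denominator_unit (q : rat) (c d : nat) : (0 < d)%N ->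
  (1 - vary) * (1 - varz ^+ d * vary ^+ c - model_polynomial q c)
    \is a GRing.unit.
Proof.
move=> d_gt0; rewrite fps2_unitE /coef2 !coefs0M !coefsB.
rewrite -[coefs (coefs (varz ^+ d * _) 0) 0]/(coef2 _ 0 0) coef2_monomial.
rewrite /= [_ == d]eq_sym gtn_eqF //= !subr0 mul1r.
suff -> : coefs (coefs (model_polynomial q c) 0) 0 = 0 by rewrite subr0.
rewrite /model_polynomial; elim/big_ind: _ => // [F G F0 G0 | i _].
  by rewrite !coefsD F0 G0.
by rewrite -[LHS]/(coef2 _ 0 0) coef2_monomial.
Qed.

(* Main.v *)
Require Import Defs.
From mathcomp Require Import all_boot all_order all_algebra boolp.

(* Put M(b) = 1 + floor(b / q), the least a with b < a q.  A run 0^a 1^b with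
   a >= M(b) is read as 0^(a - M(b)) followed by 0^(M(b)) 1^b, and each of the
   a - M(b) leftover zeros is a block 0^(M(0)) 1^0, as M(0) = 1.  So a word of
   W_q is, in a unique way, 1^k followed by blocks 0^(M(b)) 1^b, whence
   W_q = 1 / ((1 - y) (1 - B)) with B = \sum_b z^(M(b)) y^b; and
   M(b + c) = M(b) + d gives (1 - z^d y^c) B = P_q. *)

Set Implicit Arguments.
Unset Strict Implicit.
Unset Printing Implicit Defensive.

Import Order.TTheory GRing.Theory Num.Theory.
Local Open Scope ring_scope.

(** * Final runs of a word *)

Lemma cat_eq_catl (T : Type) (s1 s2 t1 t2 : seq T) :
  s1 ++ s2 = t1 ++ t2 -> (size s1 <= size t1)%N ->
  exists2 s, t1 = s1 ++ s & s2 = s ++ t2.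
Proof.
move=> e le_s1t1; exists (drop (size s1) t1).
  rewrite -{1}(cat_take_drop (size s1) t1) -(takel_cat t2 le_s1t1) -e.
  by rewrite take_size_cat.
have /(congr1 (drop (size s1))) := e; rewrite drop_size_cat // drop_cat.
case: ltnP => // ge_t1s1.
have -> : size s1 = size t1 by apply/eqP; rewrite eqn_leq le_s1t1.
by rewrite subnn drop0 drop_size.
Qed.

Lemma nseqSr (T : Type) (n : nat) (x : T) : nseq n.+1 x = rcons (nseq n x) x.
Proof. by elim: n => //= n <-. Qed.

(** The default [~~ x] of [last] admits an empty prefix; a nonempty one ends in the other letter, so
    the run is maximal. *)
Lemma trailing_run (x : bool) (s : seq bool) :
  exists2 p : seq bool * nat, s = p.1 ++ nseq p.2 x & last (~~ x) p.1 = ~~ x.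
Proof.
elim/last_ind: s => [|s y [[u n] /= es lu]]; first by exists ([::], 0%N).
have [->|ne_yx] := eqVneq y x.
  by exists (u, n.+1) => //; rewrite [LHS]/= es nseqSr rcons_cat.
exists (rcons s y, 0%N); rewrite /= ?cats0 // last_rcons.
by case: x y ne_yx {es lu} => [] [].
Qed.

Lemma trailing_run_inj (x : bool) (u v : seq bool) (m n : nat) :
  last (~~ x) u = ~~ x -> last (~~ x) v = ~~ x ->
  u ++ nseq m x = v ++ nseq n x -> u = v /\ m = n.
Proof.
have neq (s : seq bool) k : last (~~ x) (s ++ nseq k.+1 x) <> ~~ x.
  by rewrite nseqSr -rcons_cat last_rcons; case: x.
move=> lu lv; elim: m n => [|m IHm] [|n]; rewrite ?cats0 => e.
- by [].
- by case: (neq v n); rewrite -e.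
- by case: (neq u m); rewrite e.
move: e; rewrite !nseqSr -!rcons_cat => /rcons_inj[/IHm[-> ->]].
by [].
Qed.

Lemma sorted_no_descent (m n : nat) (u v : seq bool) :
  nseq m false ++ nseq n true <> u ++ [:: true, false & v].
Proof.
elim: m u => [|m IHm] [|y u] //=; last by case=> _ /IHm.
- by move/(congr1 (fun s => false \in s)); rewrite mem_nseq !inE andbF.
- move/(congr1 (fun s => false \in s)).
  by rewrite mem_nseq inE mem_cat !inE !orbT andbF.
Qed.

(** * Adding and removing a final block *)

Lemma words_prefix (q : rat) (w t : seq bool) :
  0 < q -> words q (w ++ false :: t) -> words q w.
Proof.
move=> q_gt0 Lw a [|b] a_gt0 [u [v [ew lu hv ht]]].
  (* With b = 0 the appended 0 may lengthen the zero run, but 0 < a q holds anyway; with b > 0 the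
     factor stays maximal. *)
  by rewrite mulr_gt0 ?ltr0n.
apply: Lw => //; exists u, (v ++ false :: t); split=> //.
- by rewrite ew -!catA.
- by case: (v) ht.
Qed.

Definition block_zeros (q : rat) (b : nat) : nat := 1 + Num.truncn (b%:R / q).

(** As b / q >= 0, floor(b / q) < a means b / q < a. The condition on a factor thus becomes a lower
    bound on its zeros. *)
Lemma block_zeros_leq (q : rat) (a b : nat) : 0 < q ->
  (block_zeros q b <= a)%N = (b%:R < a%:R * q).
Proof.
move=> q_gt0; rewrite /block_zeros add1n truncn_lt_nat ?divr_ge0 ?ler0n ?ltW //.
by rewrite ltr_pdivrMr.
Qed.

Definition block (q : rat) (b : nat) : seq bool :=
  nseq (block_zeros q b) false ++ nseq b true.

(** A factor at the end of the new word contains all zeros of the block, which suffices; any other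
    one is followed by a 0 and is already maximal in [w]. *)
Lemma words_block (q : rat) (w : seq bool) (b : nat) :
  0 < q -> words q w -> words q (w ++ block q b).
Proof.
rewrite /block => q_gt0 Lw a' b' a'_gt0 [u [v [ew lu hv ht]]].
set M := block_zeros q b in ew.
case: v => [|[] v] // in ew hv ht *.
  rewrite cats0 !catA in ew.
  have lst s k : (0 < k)%N -> last false (s ++ nseq k false) = false.
    by case: k => // k _; rewrite nseqSr -rcons_cat last_rcons.
  have [e <-] :=
    @trailing_run_inj true _ _ _ _ (lst w M isT) (lst u a' a'_gt0) ew.
  (* The k zeros ending [w] merge with those of the block, so a' = k + M. *)
  have [[w0 k] /= ew0 lw0] := trailing_run false w.
  move: e; rewrite ew0 -catA -nseqD => /(@trailing_run_inj false _ _ _ _ lw0 lu)[_ <-].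
  by rewrite -block_zeros_leq // leq_addl.
(* A 0 follows the factor, so by [hv] it ends in a 1. *)
case: b' => // b' in ew hv *.
have e : w ++ (nseq M false ++ nseq b true) =
    (u ++ nseq a' false ++ nseq b'.+1 true) ++ false :: v.
  by rewrite ew !catA.
have [le|/ltnW le] :=
  leqP (size (u ++ nseq a' false ++ nseq b'.+1 true)) (size w).
  have [s ew0 ev] := cat_eq_catl (esym e) le.
  apply: Lw => //; exists u, s; split=> //; first by rewrite ew0 -!catA.
  by case: s ev {ew0} => //= x s [<-].
have [s eX es] := cat_eq_catl e le.
case/lastP: s => [|s x] in eX es *.
  rewrite cats0 in eX; apply: Lw => //; exists u, [::]; split=> //.
  by rewrite cats0 -eX.
(* Now the factor would end inside the block, with its last 1 followed by a 0. *)
have ex : x = true.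
  rewrite -(last_rcons true (w ++ s) x) rcons_cat -eX.
  by rewrite nseqSr -!rcons_cat last_rcons.
rewrite ex cat_rcons in es.
by case: (sorted_no_descent es).
Qed.

Lemma words_nseq_true (q : rat) (n : nat) : words q (nseq n true).
Proof.
move=> [|a] b // _ [u [v [e _ _ _]]].
have /(congr1 (fun s => false \in s)) := e.
by rewrite mem_nseq !mem_cat inE orbT andbF.
Qed.

(** The last factor 0^a 1^b has a >= M(b): the block takes M(b) of its zeros and [w'] keeps the
    others. *)
Lemma words_split (q : rat) (w : seq bool) :
  0 < q -> words q w -> false \in w ->
  exists w' b, words q w' /\ w = w' ++ block q b.
Proof.
move=> q_gt0 Lw w0.
have [[s b] /= ew ls] := trailing_run true w.
have [[u [|a]] /= es lu] := trailing_run false s.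
  (* With no zero before the final ones, [s] is empty, against [w0], or its last letter is both 0
     and 1. *)
  rewrite cats0 in es; case/lastP: u => [|u x] in es lu.
    by move: w0; rewrite ew es /= mem_nseq andbF.
  by move: ls lu; rewrite es !last_rcons => ->.
have lt_b : b%:R < a.+1%:R * q.
  apply: Lw => //; exists u, [::]; split=> //; last by case: (b).
  by rewrite cats0 ew es catA.
have le_M : (block_zeros q b <= a.+1)%N by rewrite block_zeros_leq.
have e : w = (u ++ nseq (a.+1 - block_zeros q b) false) ++ block q b.
  by rewrite ew es /block !catA -[X in _ = X ++ _]catA -nseqD subnK.
exists (u ++ nseq (a.+1 - block_zeros q b) false), b; split=> //.
(* The block computes to a word starting with 0, as [block_zeros] is a successor. *)
by move: Lw; rewrite {1}e => /(words_prefix q_gt0).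
Qed.

(** A block has at least one zero, so its ones are the whole final run of ones; this run gives b,
    and equal suffixes cancel. *)
Lemma block_inj (q : rat) (w w' : seq bool) (b b' : nat) :
  w ++ block q b = w' ++ block q b' -> w = w' /\ b = b'.
Proof.
have lst s k : last false (s ++ nseq (block_zeros q k) false) = false.
  by rewrite /block_zeros add1n nseqSr -rcons_cat last_rcons.
rewrite /block !catA.
move=> /(@trailing_run_inj true _ _ _ _ (lst w b) (lst w' b'))[e eb].
split=> //; apply/eqP; move/eqP: e; rewrite eb.
have [es|ne] := eqVneq (size w) (size w'); first by rewrite eqseq_cat // eqxx andbT.
move/eqP/(congr1 size); rewrite !size_cat => /addIn es.
by rewrite es eqxx in ne.
Qed.

(** * Counting words by their last block *)

(** Plain sequences instead of tuples, since removing a block changes the length and hence the tuple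
    type. *)
Definition word_list (q : rat) (r i : nat) : seq (seq bool) :=
  [seq tval t | t <- enum [set w : (r + i).-tuple bool |
      [&& `[< words q w >], count_mem false w == r & count_mem true w == i]]].

Lemma size_word_list (q : rat) (r i : nat) :
  size (word_list q r i) = nb_words q r i.
Proof. by rewrite size_map -cardE. Qed.

Lemma uniq_word_list (q : rat) (r i : nat) : uniq (word_list q r i).
Proof. by rewrite map_inj_uniq ?enum_uniq //; apply: val_inj. Qed.

Lemma word_listP (q : rat) (r i : nat) (w : seq bool) :
  reflect [/\ words q w, count_mem false w = r & count_mem true w = i]
          (w \in word_list q r i).
Proof.
apply: (iffP mapP) => [[t] | [Lw er ei]].
  by rewrite mem_enum inE => /and3P[/asboolP Lt /eqP er /eqP ei] ->.
have sz : size w == (r + i)%N.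
  rewrite -er -ei -(count_predC (pred1 false)) eqn_add2l; apply/eqP.
  by apply: eq_count => - [].
exists (Tuple sz) => //; rewrite mem_enum inE er ei !eqxx !andbT.
exact/asboolP.
Qed.

Lemma all_true_nseq (w : seq bool) :
  count_mem false w = 0%N -> w = nseq (count_mem true w) true.
Proof.
elim: w => [|[] w IHw] //=.
by rewrite add0n => /IHw {1}->.
Qed.

Lemma nb_words0 (q : rat) (i : nat) : nb_words q 0 i = 1%N.
Proof.
rewrite -size_word_list -[RHS]/(size [:: nseq i true]); apply: perm_size.
apply: uniq_perm; rewrite ?uniq_word_list // => w; rewrite inE.
apply/word_listP/eqP => [[_ /all_true_nseq ew <-] // | ->].
by split; rewrite ?count_nseq ?mul1n //; apply: words_nseq_true.
Qed.

(** As r > 0, each word has a last block, unique by [block_inj]; b is its number of ones. *)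
Lemma nb_wordsS (q : rat) (r i : nat) : 0 < q -> (0 < r)%N ->
  nb_words q r i =
  (\sum_(b < i.+1 | block_zeros q b <= r)
      nb_words q (r - block_zeros q b) (i - b))%N.
Proof.
move=> q_gt0 r_gt0; rewrite -size_word_list.
pose bs := [seq b <- iota 0 i.+1 | block_zeros q b <= r]%N.
pose L := [seq w ++ block q b | b <- bs,
  w <- word_list q (r - block_zeros q b) (i - b)].
have countF b : count_mem false (block q b) = block_zeros q b.
  by rewrite /block count_cat !count_nseq mul1n addn0.
have countT b : count_mem true (block q b) = b.
  by rewrite /block count_cat !count_nseq mul1n.
have /perm_size -> : perm_eq (word_list q r i) L.
  apply: uniq_perm; first exact: uniq_word_list.
    apply: allpairs_uniq_dep => [|b _|[b w] [b' w'] _ _ /= /block_inj[-> ->]] //.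
    - by rewrite filter_uniq ?iota_uniq.
    - exact: uniq_word_list.
  move=> w; apply/word_listP/allpairsPdep => [[Lw er ei] | [b [w' [bs_b]]]].
    have w0 : false \in w by rewrite -has_pred1 has_count er.
    have [w' [b [Lw' ew]]] := words_split q_gt0 Lw w0.
    move: er ei; rewrite ew 2!(count_cat _ w') countF countT => er ei.
    exists b, w'; split=> //.
      by rewrite mem_filter mem_iota -er leq_addl add0n ltnS -ei leq_addl.
    by apply/word_listP; split=> //; rewrite -?er -?ei addnK.
  move: bs_b; rewrite mem_filter mem_iota add0n ltnS => /andP[le_r /= le_i].
  move=> /word_listP[Lw' er ei] ->; split; first exact: words_block.
    by rewrite (count_cat _ w') countF er subnK.
  by rewrite (count_cat _ w') countT ei subnK.
rewrite size_allpairs_dep sumnE big_map big_filter.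
rewrite -[iota 0 i.+1]/(index_iota 0 i.+1) big_mkord.
by apply: eq_bigr => b _; rewrite size_word_list.
Qed.

(** * Generating series *)

Lemma coefs_sum (R : comNzRingType) (I : Type) (r : seq I) (P : pred I)
    (F : I -> fps R) (n : nat) :
  coefs (\sum_(i <- r | P i) F i) n = \sum_(i <- r | P i) coefs (F i) n.
Proof. by elim/big_rec2: _ => // i x y _ <-. Qed.

(** The series 1 / (1 - y), which counts the words 1^k. *)
Definition ones_series : fps2 := FPS (fun r => FPS (fun=> (r == 0%N)%:R)).

(** The infinite sum B, given by its coefficients. *)
Definition block_series (q : rat) : fps2 :=
  FPS (fun r => FPS (fun i => (r == block_zeros q i)%:R)).

Lemma fps2P (F G : fps2) :
  (forall r i, coef2 F r i = coef2 G r i) -> F = G.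
Proof. by move=> FG; apply: fpsP => r; apply: fpsP => i; apply: FG. Qed.

Lemma coef2D (F G : fps2) (r i : nat) :
  coef2 (F + G) r i = coef2 F r i + coef2 G r i.
Proof. by []. Qed.

Lemma coef2M (F G : fps2) (r i : nat) :
  coef2 (F * G) r i =
  \sum_(k < r.+1) \sum_(j < i.+1) coef2 F k j * coef2 G (r - k) (i - j).
Proof. by rewrite /coef2 coefsM coefs_sum. Qed.

Lemma coef2B (F G : fps2) (r i : nat) :
  coef2 (F - G) r i = coef2 F r i - coef2 G r i.
Proof. by []. Qed.

Lemma coef2_monomialM (a b : nat) (F : fps2) (r i : nat) :
  coef2 (varz ^+ a * vary ^+ b * F) r i =
  if (a <= r)%N && (b <= i)%N then coef2 F (r - a) (i - b) else 0.
Proof.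
rewrite -mulrA /coef2 coefsXnM; case: leqP => // _.
by rewrite fpsCX coefsCM coefsXnM.
Qed.

Lemma ones_seriesE : (1 - vary) * ones_series = 1.
Proof.
apply: fps2P => r i; rewrite mulrBl mul1r coef2B.
(* Write y as z^0 y^1, and below 1 as z^0 y^0, to use the monomial lemmas. *)
rewrite -[vary]mul1r -[X in X * vary](expr0 varz) -[vary]expr1.
rewrite coef2_monomialM subn0 /=.
rewrite -[1](mulr1 (1 : fps2)) -{1}(expr0 varz) -(expr0 vary) coef2_monomial.
by case: i => [|i]; rewrite /coef2 /= ?subr0 ?andbT // subrr andbF.
Qed.

Lemma W_recurrence (q : rat) :
  0 < q -> W q = ones_series + block_series q * W q.
Proof.
move=> q_gt0; apply: fps2P => r i; rewrite coef2D coef2M exchange_big /= /coef2 /=.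
(* For fixed b, only k = M(b) contributes to the inner sum. *)
under eq_bigr => b _.
  rewrite (eq_bigr (fun k : 'I_r.+1 => if k == block_zeros q b :> nat
     then (nb_words q (r - block_zeros q b) (i - b))%:Z else 0)); last first.
    by move=> k _; case: eqP => [->|_]; rewrite ?mul1r ?mul0r.
  rewrite -big_mkcond /= (big_ord1_eq _ (fun=> _)) ltnS. over.
(* For r = 0 the sum is empty, as M(b) > 0, and [ones_series] gives the 1. *)
rewrite /= -big_mkcond /=; case: (posnP r) => [-> | r_gt0].
  by rewrite nb_words0 big1.
rewrite nb_wordsS // (big_morph Posz PoszD (erefl 0%Z)).
by rewrite add0r.
Qed.

(** Here c / q is the integer d, which comes out of the floor. *)
Lemma block_zeros_add (q : rat) (c d i : nat) :
  0 < q -> c%:R = d%:R * q -> block_zeros q (c + i) = (d + block_zeros q i)%N.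
Proof.
move=> q_gt0 ec; rewrite /block_zeros natrD mulrDl {1}ec mulfK ?gt_eqF //.
by rewrite truncnD ?natr_nat ?nnegrE ?divr_ge0 ?ler0n ?(ltW q_gt0) // natrK addnCA.
Qed.

(** Shifting the exponents (M(b), b) by (d, c) gives those with b >= c, so the difference keeps the
    terms with b < c. *)
Lemma block_seriesE (q : rat) (c d : nat) :
  (0 < c)%N -> (0 < d)%N -> q = c%:R / d%:R ->
  (1 - varz ^+ d * vary ^+ c) * block_series q = model_polynomial q c.
Proof.
move=> c_gt0 d_gt0 q_eq; apply: fps2P => r i.
rewrite mulrBl mul1r coef2B coef2_monomialM.
have q_gt0 : 0 < q by rewrite q_eq divr_gt0 ?ltr0n.
have ec : c%:R = d%:R * q by rewrite q_eq mulrC divfK // pnatr_eq0 -lt0n.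
rewrite {3}/coef2 !coefs_sum.
rewrite (eq_bigr (fun j : 'I_c =>
    if j == i :> nat then (r == block_zeros q j)%:R else 0)); last first.
  move=> j _; rewrite -[LHS]/(coef2 _ r i) coef2_monomial.
  by rewrite andbC eq_sym; case: eqP.
rewrite -big_mkcond /= (big_ord1_eq _ (fun j => (r == block_zeros q j)%:R)) /coef2 /=.
case: ltnP => [_ | le_ci]; first by rewrite andbF subr0.
(* With M(i) = d + M(i - c), the two coefficients agree if d <= r and both vanish if r < d. *)
rewrite andbT -{1}(subnKC le_ci) (block_zeros_add _ q_gt0 ec).
case: leqP => [le_dr | lt_rd].
  by rewrite -{1}(subnKC le_dr) eqn_add2l subrr.
by rewrite ltn_eqF ?subr0 // ltn_addr.
Qed.

Theorem theorem1 (q : rat) (c d : nat)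
    (c_gt0 : (0 < c)%N) (d_gt0 : (0 < d)%N)
    (coprime_cd : coprime c d) (q_eq : q = c%:R / d%:R) :
  W q = (1 - varz ^+ d * vary ^+ c) /
        ((1 - vary) * (1 - varz ^+ d * vary ^+ c - model_polynomial q c)).
Proof.
have q_gt0 : 0 < q by rewrite q_eq divr_gt0 ?ltr0n.
apply: (mulIr (denominator_unit q c d_gt0)); rewrite divrK ?denominator_unit //.
have W_series : W q * (1 - block_series q) = ones_series.
  by rewrite mulrBr mulr1 {1}(W_recurrence q_gt0) [W q * _]mulrC addrK.
(* With P_q = D B, the second factor of the denominator is D (1 - B). *)
rewrite -(block_seriesE c_gt0 d_gt0 q_eq); set D := 1 - _ * _.
have -> : D - D * block_series q = D * (1 - block_series q).
  by rewrite mulrBr mulr1.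
by rewrite mulrCA (mulrCA (W q)) W_series mulrCA ones_seriesE mulr1.
Qed.
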